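(* Let $f$ satisfy $(\mathcal A)$ and let $p\ge1$. Let $y_{-1},y_0\in\mathcal H$ with $y_0\neq y_{-1}$, and define recursively for $k\ge0$ $$\lambda_k=\|y_k-y_{k-1}\|^{-\frac{p-1}{p}},\qquad y_{k+1}=\operatorname{prox}_{\lambda_k f}(y_k),$$ and assume $\nabla f(y_k)\neq0$ for all $k\ge0$ (so the iteration never stops and all $\lambda_k$ are well defined). Then $f(y_k)-\inf_{\mathcal H}f=o\big(k^{-(2-\frac1p)}\big)$ as $k\to+\infty$, and $(y_k)_{k\ge0}$ converges weakly to an element of $S=\operatorname{argmin} f$.
   Context: $\mathcal H$ is a real Hilbert space. Assumption $(\mathcal A)$: $f:\mathcal H\to\mathbb R$ is convex and continuously differentiable, $S=\operatorname{argmin}_{\mathcal H} f\neq\emptyset$, and $\nabla f$ is Lipschitz continuous on bounded subsets of $\mathcal H$. For $\lambda>0$, $\operatorname{prox}_{\lambda f}(y)=\operatorname{argmin}_{u\in\mathcal H}\{f(u)+\frac{1}{2\lambda}\|u-y\|^2\}$. *)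

(* Defs.v *)
From HB Require Import structures.
From mathcomp Require Import all_boot all_order all_algebra.
From mathcomp Require Import all_classical all_reals all_analysis.
Set Implicit Arguments. Unset Strict Implicit. Unset Printing Implicit Defensive.
Import Order.TTheory GRing.Theory Num.Theory.
Import numFieldNormedType.Exports.
Local Open Scope ring_scope.
Local Open Scope classical_set_scope.

Definition hilbert_inner (R : realType) (V : completeNormedModType R)
  (inner : V -> V -> R) : Prop :=
  [/\ (forall x y, inner x y = inner y x),
      (forall x y z, inner (x + y) z = inner x z + inner y z),
      (forall (a : R) x y, inner (a *: x) y = a * inner x y)
    & (forall x, `|x| ^+ 2 = inner x x)].

Definition convex_fun (R : realType) (V : normedModType R) (f : V -> R) : Prop :=
  forall (x y : V) (t : R), 0 <= t <= 1 ->
    f (t *: x + (1 - t) *: y) <= t * f x + (1 - t) * f y.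

Definition is_gradient (R : realType) (V : normedModType R)
  (inner : V -> V -> R) (f : V -> R) (g : V -> V) : Prop :=
  forall x, differentiable f x /\ forall h, 'd f x h = inner (g x) h.

Definition lipschitz_on_bounded (R : realType) (V : normedModType R)
  (g : V -> V) : Prop :=
  forall M : R, exists L : R, forall x y : V, `|x| <= M -> `|y| <= M ->
    `|g x - g y| <= L * `|x - y|.

Definition is_argmin (R : realType) (V : normedModType R) (f : V -> R) (x : V) :=
  forall u, f x <= f u.

Definition is_prox (R : realType) (V : normedModType R) (lam : R) (f : V -> R)
  (y u : V) : Prop :=
  forall v, f u + (2 * lam)^-1 * `|u - y| ^+ 2 <= f v + (2 * lam)^-1 * `|v - y| ^+ 2.

(* Main.v *)
Require Import Defs.
From HB Require Import structures.
From mathcomp Require Import all_boot all_order all_algebra.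
From mathcomp Require Import all_classical all_reals all_analysis.
From mathcomp Require Import ring lra zify.
Set Implicit Arguments. Unset Strict Implicit. Unset Printing Implicit Defensive.
Import Order.TTheory GRing.Theory Num.Theory.
Import numFieldNormedType.Exports.
Local Open Scope ring_scope.
Local Open Scope classical_set_scope.

(* Write s_n for the sum of the first n step sizes, g_n for the gradient norm at
   y_n and q = (p-1)/p.  For any proximal point iteration and any minimiser x,
   2 s_n (f(y_n) - min f) + |y_n - x|^2 + s_n^2 g_n^2 is nonincreasing, so
   g_n = O(1/s_n).  The feedback law reads lambda_{k+1} = (lambda_k g_{k+1})^(-q),
   whence lambda_{k+1} lambda_k^q >= (s_{k+1}/D)^q, a difference inequality that
   forces s_n >= c n^(1+q) with 1+q = 2 - 1/p.  As f(y_n) decreases and the sum of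
   lambda_k (f(y_{k+1}) - min f) is finite, f(y_n) - min f = o(1/s_n).
   Weak convergence is Opial's argument: distances to minimisers are
   nonincreasing and weak cluster points are minimisers. *)

(** * Limits along ultrafilters *)

(** By compactness of [[-M, M]] the image filter has a cluster point. An ultrafilter contains the
    preimage of each neighbourhood or its complement, so it converges there. *)
Lemma bounded_ultra_cvg {R : realType} {T : Type} (U : set_system T) (u : T -> R)
    (M : R) :
  UltraFilter U -> (forall t, `|u t| <= M) -> exists l : R, u @ U --> l.
Proof.
move=> UU uM.
have PU : ProperFilter U by exact: ultra_proper.
have uI t : `[- M, M]%classic (u t) by rewrite /= in_itv /= -ler_norml.
have [|l [_ cl]] := @segment_compact R (- M) M (u @ U) _ _.
  exact: (@filterE _ U _ (u @^-1` `[- M, M]%classic) uI).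
exists l => B Bl; rewrite /nbhs /=.
have [//|UB] := in_ultra_setVsetC (u @^-1` B) UU.
by have [r [nBr Br]] := cl (~` B) B UB Bl.
Qed.

(** * Hilbert space geometry: Riesz representation, weak compactness, Opial's lemma *)

Section InnerProduct.
Context {R : realType} {V : completeNormedModType R} {inner : V -> V -> R}.
Hypothesis hI : hilbert_inner inner.

Lemma innerC x y : inner x y = inner y x.
Proof. by case: hI. Qed.

Lemma innerDl x y z : inner (x + y) z = inner x z + inner y z.
Proof. by case: hI. Qed.

Lemma innerZl (a : R) x y : inner (a *: x) y = a * inner x y.
Proof. by case: hI. Qed.

Lemma inner_sqr x : inner x x = `|x| ^+ 2.
Proof. by case: hI. Qed.

Lemma innerNl x y : inner (- x) y = - inner x y.
Proof. by rewrite -scaleN1r innerZl mulN1r. Qed.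

Lemma innerBl x y z : inner (x - y) z = inner x z - inner y z.
Proof. by rewrite innerDl innerNl. Qed.

Lemma innerDr x y z : inner z (x + y) = inner z x + inner z y.
Proof. by rewrite ![inner z _]innerC innerDl. Qed.

Lemma innerZr (a : R) x y : inner x (a *: y) = a * inner x y.
Proof. by rewrite ![inner x _]innerC innerZl. Qed.

Lemma innerNr x y : inner x (- y) = - inner x y.
Proof. by rewrite ![inner x _]innerC innerNl. Qed.

Lemma innerBr x y z : inner z (x - y) = inner z x - inner z y.
Proof. by rewrite ![inner z _]innerC innerBl. Qed.

Lemma normD_sqr x y : `|x + y| ^+ 2 = `|x| ^+ 2 + 2 * inner x y + `|y| ^+ 2.
Proof. by rewrite -!inner_sqr innerDl !innerDr (innerC y x); ring. Qed.

Lemma normB_sqr x y : `|x - y| ^+ 2 = `|x| ^+ 2 - 2 * inner x y + `|y| ^+ 2.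
Proof. by rewrite normD_sqr innerNr normrN; ring. Qed.

(* The norm is already known to be subadditive, so squaring the triangle
   inequality is enough. *)
Lemma inner_le_norm x y : inner x y <= `|x| * `|y|.
Proof.
have h : `|x + y| ^+ 2 <= (`|x| + `|y|) ^+ 2.
  by rewrite lerXn2r ?nnegrE ?addr_ge0 ?ler_normD.
move: h; rewrite normD_sqr => h; nra.
Qed.

Lemma Cauchy_Schwarz x y : `|inner x y| <= `|x| * `|y|.
Proof.
rewrite ler_norml inner_le_norm andbT lerNl -innerNl -(normrN x).
exact: inner_le_norm.
Qed.

Lemma inner_eq0 x : inner x x = 0 -> x = 0.
Proof. by rewrite inner_sqr => /eqP; rewrite sqrf_eq0 normr_eq0 => /eqP. Qed.

Lemma inner_cvg {T : Type} {F : set_system T} {FF : Filter F} (u : T -> V) x z :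
  u @ F --> x -> inner (u t) z @[t --> F] --> inner x z.
Proof.
move=> ux; apply/cvgrPdist_lt => e e0.
have e1 : 0 < e / (`|z| + 1) by rewrite divr_gt0 // ltr_wpDl.
move/cvgrPdist_lt/(_ _ e1): ux; apply: filterS => t ht.
rewrite -innerBl; apply: le_lt_trans (Cauchy_Schwarz _ _) _.
have z1 : 0 < `|z| + 1 by rewrite ltr_wpDl.
rewrite ltr_pdivlMr // in ht.
apply: le_lt_trans ht; rewrite ler_wpM2l //; lra.
Qed.

(* The representing vector minimises [|x|^2 - 2 l x]: minimising sequences are
   Cauchy by the parallelogram identity. *)
Lemma Riesz_representation (l : V -> R) (M : R) :
  (forall x y, l (x + y) = l x + l y) -> (forall a x, l (a *: x) = a * l x) ->
  (forall x, `|l x| <= M * `|x|) -> exists x, forall z, l z = inner x z.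
Proof.
move=> lD lZ lM; pose q x : R := `|x| ^+ 2 - 2 * l x.
have qlb : lbound (range q) (- M ^+ 2).
  move=> _ [x _ <-]; rewrite /q; have := lM x; rewrite ler_norml => /andP[_ h].
  have := sqr_ge0 (`|x| - M); nra.
have hq : has_lbound (range q) by exists (- M ^+ 2).
have hinf : has_inf (range q) by split => //; exists (q 0), 0.
set m := inf (range q).
have mq x : m <= q x by apply: ge_inf => //; exists x.
have /choice[x_ x_P] n : exists x, q x < m + n.+1%:R^-1.
  have n0 : 0 < (n.+1%:R^-1 : R) by rewrite invr_gt0.
  by have [_ [x _ <-] hx] := inf_adherent n0 hinf; exists x.
(* The parallelogram identity, with [m] bounding [q] from below at the midpoint of [a] and [b]. *)
have par a b : `|a - b| ^+ 2 <= 2 * (q a - m) + 2 * (q b - m).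
  have := mq (2^-1 *: (a + b)); rewrite /q normrZ exprMn lZ lD.
  rewrite normD_sqr normB_sqr ger0_norm ?invr_ge0 //; nra.
have cx : cvg (x_ @ \oo).
  apply/cauchy_cvgP/cauchy_exP => e e0.
  (* Two gaps below [e ^+ 2 / 4], each doubled by [par], add up to less than [e ^+ 2]. *)
  have e4 : 0 < e ^+ 2 / 4 by rewrite divr_gt0 // exprn_gt0.
  have [N _ HN] := near_infty_natSinv_lt (PosNum e4).
  exists (x_ N); exists N => // n /= Nn; rewrite -ball_normE /=.
  have h1 : N.+1%:R^-1 < e ^+ 2 / 4 := HN N (leqnn N).
  have h2 : n.+1%:R^-1 < e ^+ 2 / 4 := HN n Nn.
  have small k : k.+1%:R^-1 < e ^+ 2 / 4 -> q (x_ k) - m < e ^+ 2 / 4.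
    by move=> hk; rewrite ltrBlDl; apply: lt_trans (x_P k) _; rewrite ltrD2l.
  have := par (x_ N) (x_ n); have := small _ h1; have := small _ h2 => p1 p2 p3.
  rewrite -(@ltr_pXn2r _ 2) ?nnegrE //; last exact: ltW.
  lra.
exists (limn x_) => z; set x := limn x_.
set c := inner x z - l z; suff : c = 0 by rewrite /c; lra.
(* First variation taken along the minimising sequence: [q (x_ n + t *: z)] is at least [m], which
   exceeds [q (x_ n) - n.+1%:R^-1]; then n tends to infinity. *)
have key t : 0 <= 2 * t * c + t ^+ 2 * `|z| ^+ 2.
  have cv : (2 * t * (inner (x_ n) z - l z) + t ^+ 2 * `|z| ^+ 2 + n.+1%:R^-1)
      @[n --> \oo] --> 2 * t * c + t ^+ 2 * `|z| ^+ 2 + 0.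
    apply: cvgD; last exact: cvg_harmonic.
    apply: cvgD; last exact: cvg_cst.
    apply: cvgMr; apply: cvgB; last exact: cvg_cst.
    exact: inner_cvg.
  rewrite -[leRHS]addr0; apply: (cvgr_to_ge cv).
  apply: nearW => n; have := mq (x_ n + t *: z); have := x_P n.
  move: (n.+1%:R^-1 : R) => w.
  rewrite /q normD_sqr lD lZ innerZr normrZ exprMn real_normK ?num_real //; lra.
(* This [t] makes the quadratic a negative multiple of [c ^+ 2]; the [+ 1] covers [z = 0]. *)
have := key (- c / (`|z| ^+ 2 + 1)).
set H := `|z| ^+ 2; have H0 : 0 <= H by exact: sqr_ge0.
have -> : 2 * (- c / (H + 1)) * c + (- c / (H + 1)) ^+ 2 * H
  = - (c ^+ 2 * ((H + 2) / (H + 1) ^+ 2)) by field; apply/negP => /eqP; lra.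
rewrite oppr_ge0 pmulr_lle0; last first.
  by rewrite divr_gt0 ?exprn_gt0 //; lra.
by rewrite le_eqVlt ltNge sqr_ge0 orbF sqrf_eq0 => /eqP.
Qed.

(** The scalar limits along [U] depend linearly on [z] and are bounded by [M * |z|], so Riesz
    supplies the weak limit. This serves as weak compactness of balls. *)
Lemma bounded_ultra_weak_cvg {T : Type} (U : set_system T) (u : T -> V) (M : R) :
  UltraFilter U -> (forall t, `|u t| <= M) ->
  exists x, forall z, inner (u t) z @[t --> U] --> inner x z.
Proof.
move=> UU uM; have PU : ProperFilter U by exact: ultra_proper.
have ub z t : `|inner (u t) z| <= M * `|z|.
  by apply: le_trans (Cauchy_Schwarz _ _) _; rewrite ler_wpM2r.
have /choice[l lP] z : exists l : R, inner (u t) z @[t --> U] --> l.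
  exact: bounded_ultra_cvg (ub z).
have [|||x xl] := @Riesz_representation l M.
- move=> x y; apply: (cvg_unique _ (lP (x + y))) => //=.
  under eq_fun do rewrite innerDr.
  exact: cvgD.
- move=> a x; apply: (cvg_unique _ (lP (a *: x))) => //=.
  under eq_fun do rewrite innerZr.
  exact: cvgMr.
- move=> x; apply: (cvgr_to_le (cvg_norm (lP x))).
  exact: nearW (ub x).
by exists x => z; rewrite -xl.
Qed.

(* For two ultrafilter weak limits [a], [b] in [S], the convergence of
   [<u_k, a - b>] forces [a = b]. *)
Lemma Opial (S : set V) (u : nat -> V) (M : R) :
  (forall k, `|u k| <= M) ->
  (forall s, S s -> cvgn (fun k => `|u k - s|)) ->
  (forall (U : set_system nat) x, UltraFilter U -> \oo `<=` U ->
     (forall z, inner (u k) z @[k --> U] --> inner x z) -> S x) ->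
  exists2 x, S x & forall z, inner (u k) z @[k --> \oo] --> inner x z.
Proof.
move=> uM uS US.
have uniq (G H : set_system nat) a b : UltraFilter G -> UltraFilter H ->
    \oo `<=` G -> \oo `<=` H ->
    (forall z, inner (u k) z @[k --> G] --> inner a z) ->
    (forall z, inner (u k) z @[k --> H] --> inner b z) -> a = b.
  move=> UG UH oG oH Ga Hb.
  have PG : ProperFilter G by exact: ultra_proper.
  have PH : ProperFilter H by exact: ultra_proper.
  have Sa := US _ _ UG oG Ga; have Sb := US _ _ UH oH Hb.
  have [c cc] : exists c : R, inner (u k) (a - b) @[k --> \oo] --> c.
    (* In the difference of the squared distances to [a] and [b] the term [|u k| ^+ 2] cancels. *)
    have E k : inner (u k) (a - b) = 2^-1 * (`|u k - b| ^+ 2 - `|u k - a| ^+ 2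
        - (`|b| ^+ 2 - `|a| ^+ 2)).
      by rewrite innerBr !normB_sqr; field.
    eexists; under eq_fun do rewrite E.
    apply: cvgMr; apply: cvgB; last exact: cvg_cst.
    by apply: cvgB; apply: cvgM; [exact: (uS _ Sb)|exact: (uS _ Sb)
      |exact: (uS _ Sa)|exact: (uS _ Sa)].
  have ca : inner a (a - b) = c.
    apply: (cvg_unique _ (Ga (a - b))) => //.
    by apply: cvg_trans cc => A /oG.
  have cb : inner b (a - b) = c.
    apply: (cvg_unique _ (Hb (a - b))) => //.
    by apply: cvg_trans cc => A /oH.
  by apply/subr0_eq/inner_eq0; rewrite innerBl ca cb subrr.
have [U [UU oU]] := @ultraFilterLemma nat \oo _.
have [x xP] := bounded_ultra_weak_cvg UU uM.
exists x => [|z B Bx]; first exact: US xP.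
rewrite /nbhs /=; apply: contrapT => nB.
(* If convergence fails at [B], the indices outside [A] meet every tail. An ultrafilter through them
   has the same weak limit by [uniq], hence also contains [A]. *)
pose A := [set k | B (inner (u k) z)].
have PW : ProperFilter (within (~` A) \oo).
  split; last exact: within_filter.
  move=> nA; apply: nB; move: nA; rewrite /within /=; apply: filterS => k /= nk.
  by apply: contrapT.
have [G [UG wG]] := ultraFilterLemma PW.
have oG : \oo `<=` G by move=> C oC; apply: wG; apply: filterS oC.
have [x' x'P] := bounded_ultra_weak_cvg UG uM.
have PG : ProperFilter G by exact: ultra_proper.
have xx' : x = x' by exact: uniq xP x'P.
have GA : G A by apply: x'P; rewrite -xx'.
have GnA : G (~` A) by apply: wG; rewrite /within /=; exact: nearW.
by have [k []] := filter_ex (filterI GA GnA).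
Qed.
End InnerProduct.

(** * Real sequences: little-o rates and growth of partial sums *)

(** Split [S n * F n] at a fixed [m]. Monotonicity of [F] bounds [(S n - S m) * F n] by a tail of
    the convergent series [T]; the rest, [S m * F n], is at most [S m * C / S n], which vanishes. *)
Lemma nonincreasing_series_mul_cvg0 {R : realType} (a F : nat -> R) (C : R) :
  (forall k, 0 <= a k) -> nonincreasing_seq F -> (forall k, 0 <= F k) ->
  (forall n, series (fun k => a k * F k.+1) n <= C) ->
  series a @ \oo --> +oo -> (series a n * F n) @[n --> \oo] --> 0.
Proof.
move=> a0 dF F0 TC Soo; set S := series a.
set T := series (fun k => a k * F k.+1) in TC *.
have S0 n : 0 <= S n by rewrite /S seriesEnat sumr_ge0.
have T0 n : 0 <= T n.
  by rewrite /T seriesEnat sumr_ge0 // => k _; rewrite mulr_ge0.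
have ndT : nondecreasing_seq T.
  by apply: nondecreasing_series => k _ _; rewrite mulr_ge0.
have cT : cvgn T.
  by apply: nondecreasing_is_cvgn => //; exists C => _ [n _ <-].
have ST m n : (m <= n)%N -> (S n - S m) * F n <= T n - T m.
  move=> mn; rewrite /S /T !sub_series_geq // mulr_suml.
  apply: ler_sum_nat => k /andP[_ kn]; rewrite ler_wpM2l //; exact: dF.
have SF n : S n * F n <= C.
  have := ST 0%N n isT.
  by rewrite {2}/S {2}/T /series /= !big_geq // !subr0 => /le_trans; apply.
have C0 : 0 <= C by exact: le_trans (T0 0%N) (TC 0%N).
apply/cvgrPdist_lt => e e0.
have [m mP] : exists m, limn T - T m < e / 2.
  have /cvgrPdist_lt/(_ (e / 2)) : T @ \oo --> limn T by [].
  rewrite divr_gt0 // => /(_ isT)[m _ mP]; exists m.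
  by have := mP m (leqnn m); rewrite ger0_norm // subr_ge0 nondecreasing_cvgn_le.
have [N _ NP] : \forall n \near \oo, S m * C / (e / 2) < S n.
  by move/cvgryPgt: Soo.
exists (maxn m N) => // n /=; rewrite geq_max => /andP[mn Nn].
rewrite sub0r normrN ger0_norm ?mulr_ge0 //.
have h1 : (S n - S m) * F n < e / 2.
  apply: le_lt_trans (ST _ _ mn) _; apply: le_lt_trans mP.
  by rewrite lerD2r nondecreasing_cvgn_le.
have h2 : S m * F n <= e / 2.
  have := NP _ Nn; rewrite ltr_pdivrMr ?divr_gt0 // => h.
  have Sn0 : 0 < S n.
    apply: le_lt_trans (NP _ Nn).
    by rewrite divr_ge0 ?mulr_ge0 // ltW.
  rewrite -(ler_pM2l Sn0); apply: le_trans (ltW h); rewrite mulrCA.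
  by rewrite ler_wpM2l.
lra.
Qed.

(** With [q <= 1], the q-th power of [(x + t) / x] is at most [(x + t) / x]; and [t <= x] gives
    [(x + t) ^+ 2 <= x * (x + 3 * t)]. *)
Lemma powR_step {R : realType} (q x t : R) : 0 <= q <= 1 -> 0 < t -> t <= x ->
  (x + t) `^ (1 + q) <= x `^ (1 + q) + 3 * t * x `^ q.
Proof.
move=> /andP[q0 q1] t0 tx; have x0 : 0 < x by exact: lt_le_trans tx.
have P y : 0 < y -> y `^ (1 + q) = y * y `^ q.
  move=> y0; rewrite powRD ?powRr1 ?(ltW y0) //.
  by rewrite gt_eqF // ltr_pwDl.
rewrite !P ?addr_gt0 //.
have h : (x + t) `^ q <= x `^ q * ((x + t) / x).
  have -> : x + t = x * ((x + t) / x) by rewrite mulrCA divff ?mulr1 ?gt_eqF.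
  rewrite powRM ?(ltW x0) ?divr_ge0 ?addr_ge0 ?(ltW t0) ?(ltW x0) //.
  rewrite ler_wpM2l ?powR_ge0 // [X in _ <= X](_ : _ = (x + t) / x); last first.
    by rewrite mulrCA divff ?mulr1 ?gt_eqF.
  by rewrite ler1_powR // ler_pdivlMr // mul1r lerDl ltW.
apply: (@le_trans _ _ ((x + t) * (x `^ q * ((x + t) / x)))).
  by rewrite ler_wpM2l // addr_ge0 // ltW.
have -> : (x + t) * (x `^ q * ((x + t) / x)) = x `^ q * ((x + t) ^+ 2 / x).
  by rewrite expr2; ring.
have -> : x * x `^ q + 3 * t * x `^ q = x `^ q * (x + 3 * t) by ring.
rewrite ler_wpM2l ?powR_ge0 // ler_pdivrMr //; nra.
Qed.

(* Discrete form of [sigma'^(1+q) >= (sigma/D)^q] for [sigma = series lam]; two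
   consecutive steps are merged because the bound on [lam k.+1] involves [lam k]. *)
Lemma closed_loop_growth {R : realType} (lam : nat -> R) (q D : R) :
  0 <= q <= 1 -> 0 < D -> (forall k, 0 < lam k) ->
  (forall k, (series lam k.+1 / (D * lam k)) `^ q <= lam k.+1) ->
  exists2 c, 0 < c &
    forall n, (2 <= n)%N -> (c * n%:R) `^ (1 + q) <= series lam n.
Proof.
move=> q01 D0 l0 hl; have /andP[q0 q1] := q01.
have s0 : 0 < 1 + q by rewrite ltr_pwDl.
(* With this [K], the (1+q)-th root of [(x^(1+q) / D)^q] is [x^q / K]. *)
pose K := D `^ (q / (1 + q)); have K0 : 0 < K by exact: powR_gt0.
have KE : K `^ (1 + q) = D `^ q by rewrite -powRrM divfK ?gt_eqF.
set S := series lam.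
have SS n : S n.+1 = S n + lam n by rewrite /S seriesSr.
have S00 : S 0%N = 0 by rewrite /S seriesEnat /= big_geq.
have ndS : nondecreasing_seq S.
  by apply: nondecreasing_series => k _ _; exact: ltW.
have Spos n : 0 < S n.+1.
  rewrite SS ltr_wpDl // -S00; exact: ndS.
(* The first two bounds start the induction in [even]: [t^(1+q) <= t <= S 2]. The third lets the
   gain [x^q / K] of [jump] absorb the [3 * t * x^q] of [powR_step]. *)
pose t := Num.min 1 (Num.min (S 2%N) (3 * K)^-1).
have t0 : 0 < t by rewrite !lt_min ltr01 Spos invr_gt0 mulr_gt0.
have t1 : t <= 1 by rewrite ge_min lexx.
have tS : t <= S 2%N by rewrite !ge_min lexx orbT.
have tK : 3 * t <= K^-1.
  have : t <= (3 * K)^-1 by rewrite !ge_min lexx !orbT.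
  by rewrite invfM => h; lra.
(* The sum of two consecutive steps dominates each of them, so its (1+q)-th power is at least
   [lam k.+1 * lam k ^ q], to which [hl] applies. *)
have jump k x : 0 <= x -> x `^ (1 + q) <= S k.+1 ->
    x `^ q / K <= lam k + lam k.+1.
  move=> x0 xS; rewrite leNgt; apply/negP => hlt.
  have m0 : 0 <= lam k + lam k.+1 by rewrite addr_ge0 ?ltW.
  have := gt0_ltr_powR s0 _ _ hlt; rewrite !nnegrE => /(_ m0).
  rewrite divr_ge0 ?powR_ge0 ?(ltW K0) // => /(_ isT); apply/negP; rewrite -leNgt.
  rewrite powRM ?powR_ge0 ?invr_ge0 ?(ltW K0) //.
  have -> : K^-1 `^ (1 + q) = (D `^ q)^-1.
    by rewrite -powR_inv1 ?(ltW K0) // powRAC KE powR_inv1 ?powR_ge0.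
  rewrite powRAC [leRHS]powRD; last by rewrite gt_eqF.
  rewrite powRr1 //.
  apply: (@le_trans _ _ (lam k.+1 * lam k `^ q)); last first.
    apply: ler_pM; rewrite ?powR_ge0 ?(ltW (l0 _)) //.
      by rewrite lerDr ltW.
    by rewrite ge0_ler_powR ?nnegrE ?(ltW (l0 _)) // lerDl ltW.
  apply: (@le_trans _ _ ((S k.+1 / (D * lam k)) `^ q * lam k `^ q)); last first.
    by rewrite ler_wpM2r ?powR_ge0.
  rewrite -powRM ?(ltW (l0 _)) ?divr_ge0 ?mulr_ge0 ?(ltW (l0 _)) ?(ltW D0)
    ?(ltW (Spos _)) //.
  have -> : S k.+1 / (D * lam k) * lam k = S k.+1 * D^-1.
    by field; rewrite !gt_eqF.
  rewrite powRM ?invr_ge0 ?(ltW D0) ?(ltW (Spos _)) //.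
  have -> : D^-1 `^ q = (D `^ q)^-1.
    by rewrite -powR_inv1 ?(ltW D0) // powRAC powR_inv1 ?powR_ge0.
  rewrite ler_wpM2r ?invr_ge0 ?powR_ge0 //.
  by rewrite ge0_ler_powR ?nnegrE ?powR_ge0 ?(ltW (Spos _)).
(* Each pair of steps raises the base by [t]. Starting from [j.+1] ensures [t <= x] in
   [powR_step]. *)
have even j : (t * j.+1%:R) `^ (1 + q) <= S j.+1.*2.
  elim: j => [|j IH].
    rewrite mulr1; apply: le_trans tS.
    by apply: ge1r_powR; rewrite ?t0 // lerDl.
  have x0 : 0 <= t * j.+1%:R by rewrite mulr_ge0 // ltW.
  have xS : (t * j.+1%:R) `^ (1 + q) <= S j.+1.*2.+1.
    by apply: le_trans IH _; exact: ndS.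
  have J := jump _ _ x0 xS.
  rewrite (doubleS j.+1) (SS j.+1.*2.+1) (SS j.+1.*2) -[j.+2]addn1 natrD mulrDr mulr1.
  apply: le_trans (powR_step q01 t0 _) _.
    by rewrite -[leLHS]mulr1 ler_wpM2l ?(ltW t0) // ler1n.
  rewrite -addrA; apply: lerD => //; apply: le_trans J.
  by rewrite mulrC ler_wpM2l ?powR_ge0.
(* For [n >= 2], [n] is at most three times [n./2], with equality at 3. *)
exists (t / 3); first by rewrite divr_gt0.
move=> n n2; have h2 : (0 < n./2)%N by rewrite half_gt0.
apply: (@le_trans _ _ (S (n./2).*2)); last first.
  by apply: ndS; rewrite -[leqRHS]odd_double_half leq_addl.
rewrite -(prednK h2); apply: le_trans (even _); rewrite prednK //.
rewrite ge0_ler_powR ?(ltW s0) ?nnegrE ?mulr_ge0 ?divr_ge0 ?(ltW t0) //.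
rewrite -mulrA ler_wpM2l ?(ltW t0) // mulrC ler_pdivrMr // -natrM ler_nat.
rewrite -[leqLHS]odd_double_half -muln2; move: h2; case: odd; lia.
Qed.

(** * The proximal point iteration with arbitrary positive steps *)

Section ProximalPoint.
Context {R : realType} {V : completeNormedModType R} {inner : V -> V -> R}.
Hypothesis hI : hilbert_inner inner.
Context {f : V -> R} {g : V -> V}.
Hypothesis fg : is_gradient inner f g.
Hypothesis cf : convex_fun f.

Lemma gradient_cvg x h :
  (t^-1 * (f (t *: h + x) - f x)) @[t --> 0^'+] --> inner (g x) h.
Proof.
have [dfx gx] := fg x; rewrite -gx -deriveE //.
have : derivable f x h by exact: diff_derivable.
exact: cvg_dnbhs_at_right.
Qed.

Lemma convex_gradient_le x u : f u + inner (g u) (x - u) <= f x.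
Proof.
rewrite -lerBrDl; apply: (cvgr_to_le (@gradient_cvg u (x - u))).
near=> t; have t0 : 0 < t by near: t; exact: nbhs_right_gt.
have t1 : t <= 1 by near: t; exact: nbhs_right_le.
rewrite mulrC ler_pdivrMr //.
have := @cf x u t; rewrite (ltW t0) t1 => /(_ isT).
have -> : t *: x + (1 - t) *: u = t *: (x - u) + u.
  by rewrite scalerBl scale1r scalerBr [u - _]addrC addrA.
by move=> h; lra.
Unshelve. all: by end_near. Qed.

(** Compare [u] with [t *: h + u], divide by [t > 0] and let [t] tend to 0; using both a direction
    and its opposite turns the inequality into an equation. *)
Lemma prox_gradient (lam : R) y u :
  0 < lam -> is_prox lam f y u -> lam *: g u = y - u.
Proof.
move=> l0 pu; set c := (2 * lam)^-1.
have key h : - (lam^-1 * inner (u - y) h) <= inner (g u) h.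
  have cv : (t^-1 * (f (t *: h + u) - f u) + t * (c * `|h| ^+ 2))
      @[t --> 0^'+] --> inner (g u) h + 0 * (c * `|h| ^+ 2).
    apply: cvgD; first exact: gradient_cvg.
    by apply: cvgMl; apply: cvg_at_right_filter; exact: cvg_id.
  rewrite mul0r addr0 in cv; apply: (cvgr_to_ge cv); near=> t.
  have t0 : 0 < t by near: t; exact: nbhs_right_gt.
  have := pu (t *: h + u); rewrite -/c -addrA (addrC (t *: h) (u - y)) (normD_sqr hI (u - y) (t *: h)).
  rewrite (innerZr hI) normrZ exprMn real_normK ?num_real // => hp.
  have cE : 2 * c = lam^-1 by rewrite /c invfM mulrA divff ?mul1r.
  rewrite -subr_ge0 -(pmulr_rge0 _ t0) -cE.
  have -> : t * (t^-1 * (f (t *: h + u) - f u) + t * (c * `|h| ^+ 2)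
      - - (2 * c * inner (u - y) h)) =
      f (t *: h + u) - f u + t ^+ 2 * c * `|h| ^+ 2 + 2 * t * c * inner (u - y) h.
    by field; rewrite gt_eqF.
  lra.
have eq0 : g u + lam^-1 *: (u - y) = 0.
  apply/(inner_eq0 hI).
  set w := g u + _.
  have := key w; have := key (- w); rewrite !(innerNr hI) => h1 h2.
  by rewrite {1}/w (innerDl hI) (innerZl hI); lra.
have -> : g u = - (lam^-1 *: (u - y)) by apply/eqP; rewrite -addr_eq0 eq0.
by rewrite scalerN scalerA divff ?gt_eqF // scale1r opprB.
Unshelve. all: by end_near. Qed.

Context {Y : nat -> V} {lam : nat -> R}.
Hypothesis lam0 : forall k, 0 < lam k.
Hypothesis stepE : forall k, lam k *: g (Y k.+1) = Y k - Y k.+1.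

Lemma prox_descent k :
  lam k * `|g (Y k.+1)| ^+ 2 <= f (Y k) - f (Y k.+1).
Proof.
have := convex_gradient_le (Y k) (Y k.+1).
rewrite -stepE (innerZr hI) (inner_sqr hI); lra.
Qed.

(** Adding the two gradient inequalities gives monotonicity of [g] along the step
    [lam k *: g (Y k.+1)]; Cauchy-Schwarz concludes. *)
Lemma prox_gradient_norm_le k : `|g (Y k.+1)| <= `|g (Y k)|.
Proof.
have h1 := convex_gradient_le (Y k) (Y k.+1).
have h2 := convex_gradient_le (Y k.+1) (Y k).
have h : lam k * `|g (Y k.+1)| ^+ 2 <= lam k * inner (g (Y k)) (g (Y k.+1)).
  move: h1 h2; rewrite -(opprB (Y k)) -stepE (innerNr hI) !(innerZr hI) (inner_sqr hI).
  lra.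
rewrite ler_pM2l // in h.
have := le_trans h (inner_le_norm hI _ _); have [-> //|n0] := eqVneq (g (Y k.+1)) 0.
  by rewrite normr0.
by rewrite expr2 ler_pM2r // normr_gt0.
Qed.

Lemma prox_fejer x k :
  2 * lam k * (f (Y k.+1) - f x) + lam k ^+ 2 * `|g (Y k.+1)| ^+ 2
    <= `|Y k - x| ^+ 2 - `|Y k.+1 - x| ^+ 2.
Proof.
have := convex_gradient_le x (Y k.+1); set u := Y k.+1 => h.
have -> : Y k - x = lam k *: g u + (u - x) by rewrite stepE addrA subrK.
rewrite (normD_sqr hI) (innerZl hI) normrZ exprMn real_normK ?num_real //.
have -> : inner (g u) (u - x) = - inner (g u) (x - u) by rewrite -(innerNr hI) opprB.
have := lam0 k; nra.
Qed.

(** With [s] the current sum, add [prox_fejer], [2 * s] times [prox_descent] and [s ^+ 2] times the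
    decrease of the squared gradient norm: the gradient terms form the square of [s + lam k]. *)
Lemma prox_lyapunov x k : is_argmin f x ->
  2 * series lam k * (f (Y k) - f x) + `|Y k - x| ^+ 2
    + series lam k ^+ 2 * `|g (Y k)| ^+ 2 <= `|Y 0%N - x| ^+ 2.
Proof.
move=> xmin; elim: k => [|k IH].
  by rewrite /series /= big_geq // mulr0 !mul0r add0r expr0n /= mul0r addr0.
apply: le_trans IH; rewrite seriesSr.
have S0 : 0 <= series lam k by rewrite seriesEnat sumr_ge0 // => i _; exact: ltW.
move: (series lam k) S0 (lam0 k) (prox_descent k) (prox_fejer x k) => s s0 l0 h1 h2.
have h3 : `|g (Y k.+1)| ^+ 2 <= `|g (Y k)| ^+ 2.
  by rewrite lerXn2r ?nnegrE // prox_gradient_norm_le.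
have h4 : s ^+ 2 * `|g (Y k.+1)| ^+ 2 <= s ^+ 2 * `|g (Y k)| ^+ 2.
  by rewrite ler_wpM2l // sqr_ge0.
have h5 : s * (lam k * `|g (Y k.+1)| ^+ 2) <= s * (f (Y k) - f (Y k.+1)).
  by rewrite ler_wpM2l.
lra.
Qed.

Lemma prox_gradient_rate x k : is_argmin f x ->
  series lam k * `|g (Y k)| <= `|Y 0%N - x|.
Proof.
move=> xmin; have := prox_lyapunov k xmin.
have S0 : 0 <= series lam k by rewrite seriesEnat sumr_ge0 // => i _; exact: ltW.
have F0 : 0 <= f (Y k) - f x by rewrite subr_ge0.
move=> h; rewrite -(@ler_pXn2r _ 2) ?nnegrE ?mulr_ge0 // exprMn.
have := mulr_ge0 S0 F0; have := sqr_ge0 `|Y k - x|; lra.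
Qed.

Lemma prox_value_noninc : nonincreasing_seq (fun k => f (Y k)).
Proof.
apply/nonincreasing_seqP => k; rewrite -subr_ge0.
by apply: le_trans (prox_descent k); rewrite mulr_ge0 ?sqr_ge0 // ltW.
Qed.

Lemma prox_dist_noninc x : is_argmin f x ->
  nonincreasing_seq (fun k => `|Y k - x|).
Proof.
move=> xmin; apply/nonincreasing_seqP => k.
rewrite -(@ler_pXn2r _ 2) ?nnegrE // -subr_ge0.
apply: le_trans (prox_fejer x k).
by rewrite addr_ge0 ?mulr_ge0 ?sqr_ge0 ?subr_ge0 // ltW.
Qed.

Lemma prox_value_cvg0 x : is_argmin f x -> series lam @ \oo --> +oo ->
  (series lam n * (f (Y n) - f x)) @[n --> \oo] --> 0.
Proof.
move=> xmin loo; apply: (@nonincreasing_series_mul_cvg0 _ _ _ (`|Y 0%N - x| ^+ 2)) loo.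
- by move=> k; exact: ltW.
- by move=> m n mn; rewrite lerD2r; exact: prox_value_noninc.
- by move=> k; rewrite subr_ge0.
- move=> n; suff : series (fun k => lam k * (f (Y k.+1) - f x)) n
      <= `|Y 0%N - x| ^+ 2 - `|Y n - x| ^+ 2.
    by move=> /le_trans; apply; rewrite lerBlDr lerDl sqr_ge0.
  elim: n => [|n IH]; first by rewrite /series /= big_geq // subrr.
  rewrite seriesSr; have := prox_fejer x n.
  have := mulr_ge0 (sqr_ge0 (lam n)) (sqr_ge0 `|g (Y n.+1)|).
  have : 0 <= lam n * (f (Y n.+1) - f x) by rewrite mulr_ge0 ?subr_ge0 // ltW.
  lra.
Qed.

Lemma prox_weak_cvg x : is_argmin f x -> series lam @ \oo --> +oo ->
  exists2 xs, is_argmin f xs &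
    forall z, inner (Y k) z @[k --> \oo] --> inner xs z.
Proof.
move=> xmin loo.
have bnd k : `|Y k| <= `|Y 0%N - x| + `|x|.
  rewrite -[Y k](subrK x); apply: le_trans (ler_normD _ _) _.
  by rewrite lerD2r; exact: (prox_dist_noninc xmin).
have series_pos n : 0 < series lam n.+1.
  rewrite seriesSr ltr_wpDl // seriesEnat sumr_ge0 // => i _; exact: ltW.
(* Divide the rate by [series lam n], which vanishes at [n = 0], hence the start at 1. *)
have fcv : f (Y n) @[n --> \oo] --> f x.
  have cv : (series lam n)^-1 * (series lam n * (f (Y n) - f x)) + f x
      @[n --> \oo] --> 0 * 0 + f x.
    apply: cvgD; last exact: cvg_cst.
    apply: cvgM; last exact: prox_value_cvg0.
    apply: (gtr0_cvgV0 _).2 => //; exists 1%N => // -[//|n] _.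
    exact: series_pos.
  rewrite mul0r add0r in cv; apply: cvg_trans cv; apply: near_eq_cvg.
  exists 1%N => // -[//|n] _ /=.
  by rewrite mulKf ?gt_eqF ?subrK.
have [|U u UU oU uP|xs xsP xscv] := @Opial _ _ _ hI (is_argmin f) Y _ bnd.
- move=> s smin; apply: nonincreasing_is_cvgn; first exact: prox_dist_noninc.
  by exists 0 => _ [k _ <-].
- have PU : ProperFilter U by exact: ultra_proper.
  move=> v; apply: le_trans (xmin v).
  (* The affine minorant of [f] at [u] keeps these terms above [f u], and weak convergence removes
     the inner product in the limit. *)
  have cU : f (Y k) - inner (g u) (Y k - u) @[k --> U] --> f x - (inner u (g u) - inner u (g u)).
    apply: cvgB; first by apply: cvg_trans fcv => A /oU.
    under eq_fun do rewrite (innerC hI) (innerBl hI).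
    by apply: cvgB; [exact: uP|exact: cvg_cst].
  rewrite subrr subr0 in cU; apply: (cvgr_to_ge cU).
  by apply: nearW => k; have := convex_gradient_le (Y k) u; lra.
- by exists xs.
Qed.

End ProximalPoint.

(** * The closed-loop step sizes and the conclusion *)

Lemma inf_range_argmin {R : realType} {V : normedModType R} (f : V -> R) x :
  is_argmin f x -> inf (range f) = f x.
Proof.
move=> xmin; apply/eqP; rewrite eq_le; apply/andP; split.
  by apply: ge_inf; [exists (f x) => _ [u _ <-]|exists x].
by apply: lb_le_inf => [|_ [u _ <-]] //; exists (f x), x.
Qed.

Lemma powR_growth_cvgy {R : realType} (S : nat -> R) (c r : R) :
  0 < c -> 1 <= r -> (forall n, (2 <= n)%N -> (c * n%:R) `^ r <= S n) ->
  S @ \oo --> +oo.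
Proof.
move=> c0 r1 hS; apply/cvgryPge => A.
(* The 1 in the maximum makes [c * n] at least 1, so that its power [r >= 1] dominates it. *)
have : \forall n \near \oo, (Num.max 1 A) / c <= (n%:R : R).
  by move/cvgryPge: (@cvgr_idn R).
move=> [N _ NP]; exists (maxn 2 N) => // n /=; rewrite geq_max => /andP[n2 Nn].
have := NP n Nn; rewrite /= ler_pdivrMr // mulrC ge_max => /andP[h1 hA].
by apply: le_trans (hS n n2); apply: le_trans hA _; exact: le1r_powR.
Qed.

(* Indexing: y 0 = y_{-1}, y (k.+1) = y_k. *)
Theorem mainTheorem13 (R : realType) (V : completeNormedModType R)
  (inner : V -> V -> R) (f : V -> R) (gradf : V -> V) (p : R) (y : nat -> V) :
  hilbert_inner inner ->
  convex_fun f ->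
  is_gradient inner f gradf ->
  continuous gradf ->
  lipschitz_on_bounded gradf ->
  (exists xs : V, is_argmin f xs) ->
  1 <= p ->
  y 1 != y 0 ->
  (forall k, is_prox (`|y k.+1 - y k| `^ (- ((p - 1) / p))) f (y k.+1) (y k.+2)) ->
  (forall k, gradf (y k.+1) != 0) ->
  (fun k : nat => f (y k.+1) - inf (range f))
    =o_\oo (fun k : nat => k%:R `^ (- (2 - p^-1))) /\
  exists xs : V, is_argmin f xs /\
    forall z : V, (fun k => inner (y k) z) @ \oo --> inner xs z.
Proof.
move=> hI cf fg _ _ [x xmin] p1 y10 prox g0.
have p0 : 0 < p by exact: lt_le_trans p1.
set q := (p - 1) / p in prox *.
have q0 : 0 <= q by rewrite divr_ge0 ?subr_ge0 // ltW.
have q1 : q <= 1 by rewrite ler_pdivrMr // mul1r gerBl.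
have -> : 2 - p^-1 = 1 + q by rewrite /q; field; rewrite gt_eqF.
clearbody q; pose Y k := y k.+1; pose lam k := `|y k.+1 - y k| `^ (- q).
have step k : 0 < lam k -> lam k *: gradf (Y k.+1) = Y k - Y k.+1.
  by move=> l0; apply: (prox_gradient hI fg l0); exact: prox.
(* Positivity of [lam k] needs distinct consecutive iterates, which the previous step and the
   nonzero gradient provide; hence [step] is conditional until here. *)
have d0 k : 0 < `|y k.+1 - y k|.
  elim: k => [|k IH]; first by rewrite normr_gt0 subr_eq0.
  have l0 : 0 < lam k by exact: powR_gt0.
  by rewrite distrC -(step _ l0) normrZ mulr_gt0 ?normr_gt0 ?gt_eqF ?g0.
have l0 k : 0 < lam k by exact: powR_gt0.
have {}step k := step k (l0 k).
have dE k : `|y k.+2 - y k.+1| = lam k * `|gradf (Y k.+1)|.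
  by rewrite distrC -step normrZ gtr0_norm.
pose D := `|Y 0%N - x| + 1; have D0 : 0 < D by rewrite ltr_wpDl.
(* By [dE] the displacement is [lam k] times the gradient norm, and the latter is at most
   [D / series lam k.+1]. *)
have lS k : (series lam k.+1 / (D * lam k)) `^ q <= lam k.+1.
  have -> : lam k.+1 = `|y k.+2 - y k.+1|^-1 `^ q.
    by rewrite -powR_inv1 // -powRrM mulN1r.
  have S0 : 0 <= series lam k.+1.
    by rewrite seriesEnat sumr_ge0 // => i _; exact: ltW.
  rewrite ge0_ler_powR ?nnegrE ?invr_ge0 ?divr_ge0 ?mulr_ge0 ?(ltW D0)
    ?(ltW (l0 _)) //.
  rewrite ler_pdivrMr ?mulr_gt0 // mulrC ler_pdivlMr ?d0 // dE.
  rewrite mulrCA mulrC ler_wpM2r ?(ltW (l0 _)) //.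
  apply: le_trans (prox_gradient_rate hI fg cf l0 step k.+1 xmin) _.
  by rewrite lerDl.
have q01 : 0 <= q <= 1 by rewrite q0.
have [c c0 cP] := closed_loop_growth q01 D0 l0 lS.
have s1 : 1 <= 1 + q by rewrite lerDl.
have loo : series lam @ \oo --> +oo by exact: powR_growth_cvgy cP.
split.
  rewrite (inf_range_argmin xmin); apply/eqoP => e e0.
  have C0 : 0 < c `^ (1 + q) by exact: powR_gt0.
  (* The factor [c^(1+q)] cancels when the partial sum is bounded below by [(c * n)^(1+q)]. *)
  have /cvgrPdist_le/(_ (e * c `^ (1 + q))) :=
    prox_value_cvg0 hI fg cf l0 step xmin loo.
  rewrite mulr_gt0 // => /(_ isT)[N _ NP].
  exists (maxn 2 N) => // n /=; rewrite geq_max => /andP[n2 Nn].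
  have F0 : 0 <= f (y n.+1) - f x by rewrite subr_ge0.
  have n0 : 0 < (n%:R : R) by rewrite ltr0n (leq_trans _ n2).
  have P0 : 0 < (n%:R : R) `^ (1 + q) by exact: powR_gt0.
  rewrite ger0_norm // powRN ger0_norm ?invr_ge0 ?(ltW P0) // ler_pdivlMr //.
  rewrite -(ler_pM2l C0) [leRHS]mulrC; have := NP n Nn; rewrite /= sub0r normrN.
  apply: le_trans; apply: le_trans (ler_norm _).
  rewrite mulrCA mulrC -powRM ?(ltW c0) ?(ltW n0) // ler_wpM2r //.
  exact: cP.
have [xs xsmin xscv] := prox_weak_cvg hI fg cf l0 step xmin loo.
(* [xscv] concerns [Y]; prepending the term [y 0] leaves the limit unchanged. *)
exists xs; split => // z; rewrite -cvg_shiftS; exact: xscv.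
Qed.
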